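(* Let $R$ be a commutative unital ring and let $I$ be any ideal of $R$. Put $$\mathfrak{E}:=(R\text{-Mod})_{I\text{-com}}\cap (R\text{-Mod})_{I\text{-cor}},\qquad \mathfrak{D}:=(R\text{-Mod})_{I\text{-tor}}\cap (R\text{-Mod})_{I\text{-red}}.$$ 1. For any $M\in (R\text{-Mod})_{I\text{-red}}$, $\Gamma_I(M)\in \mathfrak{E}$. 2. For any $M\in (R\text{-Mod})_{I\text{-cor}}$, $\Lambda_I(M)\in \mathfrak{D}$. 3. The functor $\Gamma_I : (R\text{-Mod})_{I\text{-red}}\rightarrow (R\text{-Mod})_{I\text{-cor}}$ restricted to $\mathfrak{D}$ is an equivalence between $\mathfrak{D}$ and $\mathfrak{E}$ with quasi-inverse $\Lambda_I$. 4. If $I$ is an idempotent ideal ($I^2=I$), then the subcategory $(R\text{-Mod})_{I\text{-com}}$ is equivalent to $(R\text{-Mod})_{I\text{-tor}}$.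
   Context: $R\text{-Mod}$ is the category of $R$-modules. The $I$-torsion functor is $\Gamma_I(M):=\varinjlim_k \mathrm{Hom}_R(R/I^k, M)$ and the $I$-adic completion functor is $\Lambda_I(M):=\varprojlim_k M/I^kM$, both endofunctors of $R\text{-Mod}$. For an $R$-module $M$ and $a\in R$ let $f_a:M\to M$ be $m\mapsto am$, and $f_a^2=f_a\circ f_a$. $M$ is $I$-reduced if $\mathrm{Ker} f_a\cong \mathrm{Ker} f_a^2$ for every $a\in I$, and $I$-coreduced if $\mathrm{Coker} f_a\cong \mathrm{Coker} f_a^2$ for every $a\in I$. $M$ is $I$-torsion if $\Gamma_I(M)\cong M$ and $I$-complete if $\Lambda_I(M)\cong M$. $(R\text{-Mod})_{I\text{-red}}$, $(R\text{-Mod})_{I\text{-cor}}$, $(R\text{-Mod})_{I\text{-tor}}$, $(R\text{-Mod})_{I\text{-com}}$ denote the full subcategories of $R\text{-Mod}$ of all $I$-reduced, $I$-coreduced, $I$-torsion, $I$-complete $R$-modules, respectively. *)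

(* Defs.v *)
From HB Require Import structures.
From mathcomp Require Import all_boot all_algebra.
From mathcomp Require Import generic_quotient ring_quotient boolp.

Set Implicit Arguments.
Unset Strict Implicit.
Unset Printing Implicit Defensive.

Import GRing.Theory.
Local Open Scope ring_scope.

Record category : Type := Category {
  obj :> Type;
  hom : obj -> obj -> Type;
  idm : forall x, hom x x;
  comp : forall x y z, hom y z -> hom x y -> hom x z;
  comp_idl : forall x y (f : hom x y), comp (idm y) f = f;
  comp_idr : forall x y (f : hom x y), comp f (idm x) = f;
  compA : forall x y z t (h : hom z t) (g : hom y z) (f : hom x y),
    comp h (comp g f) = comp (comp h g) f
}.
Arguments hom {_} _ _.
Arguments idm {_} _.
Arguments comp {_ _ _ _} _ _.

Record functor (C D : category) : Type := Functor {
  fobj :> C -> D;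
  fmap : forall x y, hom x y -> hom (fobj x) (fobj y);
  fmap_id : forall x, fmap (idm x) = idm (fobj x);
  fmap_comp : forall x y z (g : hom y z) (f : hom x y),
    fmap (comp g f) = comp (fmap g) (fmap f)
}.
Arguments fmap {_ _} _ {_ _} _.

Definition id_functor (C : category) : functor C C :=
  @Functor C C id (fun _ _ f => f) (fun _ => erefl) (fun _ _ _ _ _ => erefl).

Section CompFunctor.
Variables (C D E : category) (G : functor D E) (F : functor C D).

Let cfmap x y (f : @hom C x y) : hom (G (F x)) (G (F y)) := fmap G (fmap F f).

Fact cfmap_id x : cfmap (idm x) = idm (G (F x)).
Proof. by rewrite /cfmap !fmap_id. Qed.

Fact cfmap_comp x y z (g : hom y z) (f : hom x y) :
  cfmap (comp g f) = comp (cfmap g) (cfmap f).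
Proof. by rewrite /cfmap !fmap_comp. Qed.

Definition comp_functor : functor C E := Functor cfmap_id cfmap_comp.
End CompFunctor.

Record nat_iso (C D : category) (F G : functor C D) : Type := NatIso {
  ni_fwd : forall x, hom (F x) (G x);
  ni_bwd : forall x, hom (G x) (F x);
  ni_fwdK : forall x, comp (ni_bwd x) (ni_fwd x) = idm (F x);
  ni_bwdK : forall x, comp (ni_fwd x) (ni_bwd x) = idm (G x);
  ni_natural : forall x y (f : hom x y),
    comp (ni_fwd y) (fmap F f) = comp (fmap G f) (ni_fwd x)
}.

Definition quasi_inverse (C D : category) (F : functor C D) (G : functor D C) :
    Prop :=
  inhabited (nat_iso (comp_functor G F) (id_functor C)) /\
  inhabited (nat_iso (comp_functor F G) (id_functor D)).

Definition equivalent (C D : category) : Prop :=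
  exists (F : functor C D) (G : functor D C), quasi_inverse F G.

Definition full_subcat (C : category) (P : C -> Prop) : category :=
  @Category {x : C | P x} (fun x y => hom (sval x) (sval y))
    (fun x => idm (sval x)) (fun _ _ _ g f => comp g f)
    (fun _ _ f => comp_idl f) (fun _ _ f => comp_idr f)
    (fun _ _ _ _ h g f => compA h g f).

Definition restrict (C D : category) (F : functor C D)
    (P : C -> Prop) (Q : D -> Prop) (FPQ : forall x, P x -> Q (F x)) :
    functor (full_subcat P) (full_subcat Q) :=
  @Functor (full_subcat P) (full_subcat Q)
    (fun x => exist Q (F (sval x)) (FPQ _ (svalP x)))
    (fun x y f => fmap F f)
    (fun x => fmap_id F (sval x)) (fun _ _ _ g f => fmap_comp F g f).

Lemma linear_ext (R : comPzRingType) (U V : lmodType R)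
  (f g : {linear U -> V}) : f =1 g -> f = g.
Proof.
move: f g => [f [[f0] [fZ]]] [g [[g0] [gZ]]] /= /funext fg.
by case: _ / fg in g0 gZ *; congr (GRing.Linear.Pack (GRing.Linear.Class _ _));
  congr (_ _); exact: Prop_irrelevance.
Qed.

Section ModuleCategory.
Variable R : comPzRingType.

Fact lin_idl (U V : lmodType R) (f : {linear U -> V}) :
  (idfun \o f : {linear U -> V}) = f.
Proof. exact: linear_ext. Qed.

Fact lin_idr (U V : lmodType R) (f : {linear U -> V}) :
  (f \o idfun : {linear U -> V}) = f.
Proof. exact: linear_ext. Qed.

Fact lin_compA (U V W X : lmodType R) (h : {linear W -> X})
    (g : {linear V -> W}) (f : {linear U -> V}) :
  (h \o (g \o f) : {linear U -> X}) = (h \o g) \o f :> {linear U -> X}.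
Proof. exact: linear_ext. Qed.

Definition Mod : category :=
  @Category (lmodType R) (fun U V => {linear U -> V}) (fun U => idfun)
    (fun U V W g f => g \o f) lin_idl lin_idr lin_compA.

(* A bijective linear map has a linear inverse. *)
Definition isomorphic (U V : lmodType R) : Prop :=
  exists f : {linear U -> V}, bijective f.

End ModuleCategory.

Section HomModule.
Variables (R : comPzRingType) (U V : lmodType R).
Local Notation homUV := {linear U -> V}.
Implicit Types f g h : homUV.

HB.instance Definition _ := gen_eqMixin homUV.
HB.instance Definition _ := gen_choiceMixin homUV.

Let hzero : homUV := \0.
Let hopp f : homUV := \- f.
Let hadd f g : homUV := f \+ g.
Let hscale a f : homUV := a \*: f.

Fact haddA : associative hadd.
Proof. by move=> f g h; apply: linear_ext => x /=; rewrite addrA. Qed.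
Fact haddC : commutative hadd.
Proof. by move=> f g; apply: linear_ext => x /=; rewrite addrC. Qed.
Fact hadd0 : left_id hzero hadd.
Proof. by move=> f; apply: linear_ext => x /=; rewrite add0r. Qed.
Fact haddN : left_inverse hzero hopp hadd.
Proof. by move=> f; apply: linear_ext => x /=; rewrite addNr. Qed.

HB.instance Definition _ := GRing.isZmodule.Build homUV haddA haddC hadd0 haddN.

Fact hscaleA a b f : hscale a (hscale b f) = hscale (a * b) f.
Proof. by apply: linear_ext => x /=; rewrite scalerA. Qed.
Fact hscale1 : left_id 1 hscale.
Proof. by move=> f; apply: linear_ext => x /=; rewrite scale1r. Qed.
Fact hscaleDr : right_distributive hscale +%R.
Proof. by move=> a f g; apply: linear_ext => x /=; rewrite scalerDr. Qed.
Fact hscaleDl f : {morph hscale^~ f : a b / a + b}.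
Proof. by move=> a b; apply: linear_ext => x /=; rewrite scalerDl. Qed.

HB.instance Definition _ :=
  GRing.Zmodule_isLmodule.Build R homUV hscaleA hscale1 hscaleDr hscaleDl.
End HomModule.

Section HomFunctoriality.
Variables (R : comPzRingType) (U V W : lmodType R).

Definition precomp (p : {linear U -> V}) (f : {linear V -> W}) :
  {linear U -> W} := f \o p.
Definition postcomp (q : {linear V -> W}) (f : {linear U -> V}) :
  {linear U -> W} := q \o f.

Fact precomp_linear p : linear (precomp p).
Proof. by move=> a f g; apply: linear_ext. Qed.
HB.instance Definition _ p :=
  GRing.isLinear.Build R _ _ _ (precomp p) (precomp_linear p).

Fact postcomp_linear q : linear (postcomp q).
Proof. by move=> a f g; apply: linear_ext => x /=; rewrite linearP. Qed.
HB.instance Definition _ q :=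
  GRing.isLinear.Build R _ _ _ (postcomp q) (postcomp_linear q).
End HomFunctoriality.

Section Submodules.
Variables (R : comPzRingType) (V : lmodType R).

Definition submod (S : submodClosed V) := {x : V | x \in S}.

Section SubmodInstance.
Variable S : submodClosed V.
HB.instance Definition _ := SubChoice.on (submod S).
HB.instance Definition _ := [SubChoice_isSubLmodule of submod S by <:].
End SubmodInstance.

End Submodules.

Section Quotients.
Variables (R : comPzRingType) (V : lmodType R) (S : submodClosed V).
Local Open Scope quotient_scope.

Fact submod_oppr_closed : oppr_closed S.
Proof. by move=> x Sx; rewrite -scaleN1r rpredZ. Qed.

Let subpred : {pred V} := S.
HB.instance Definition _ := GRing.SubmodClosed.on subpred.
HB.instance Definition _ :=
  GRing.isOppClosed.Build V subpred submod_oppr_closed.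

Definition quotmod := Quotient.quot subpred.
HB.instance Definition _ := GRing.Zmodule.on quotmod.
HB.instance Definition _ := EqQuotient.on quotmod.

Definition qproj (x : V) : quotmod := \pi_quotmod x.

Lemma qprojP x y : (qproj x = qproj y) <-> (x - y \in S).
Proof.
by rewrite /qproj (@Quotient.idealrBE V subpred x y); split => [->|/eqP].
Qed.

Lemma qproj_repr (q : quotmod) : qproj (repr q) = q.
Proof. exact: reprK. Qed.

Fact qprojD : {morph qproj : x y / x + y}.
Proof. exact: Quotient.pi_add. Qed.

Let qscale (a : R) (q : quotmod) : quotmod := qproj (a *: repr q).

Let qscaleE a x : qscale a (qproj x) = qproj (a *: x).
Proof.
apply/qprojP; rewrite -scalerBr rpredZ //; apply/qprojP; exact: qproj_repr.
Qed.

Fact qscaleA a b q : qscale a (qscale b q) = qscale (a * b) q.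
Proof. by rewrite -[q]qproj_repr !qscaleE scalerA. Qed.
Fact qscale1 : left_id 1 qscale.
Proof. by move=> q; rewrite -[q]qproj_repr !qscaleE scale1r. Qed.
Fact qscaleDr : right_distributive qscale +%R.
Proof.
move=> a q r; rewrite -[q]qproj_repr -[r]qproj_repr.
by rewrite -qprojD !qscaleE scalerDr qprojD.
Qed.
Fact qscaleDl q : {morph qscale^~ q : a b / a + b}.
Proof.
by move=> a b; rewrite -[q]qproj_repr !qscaleE scalerDl qprojD.
Qed.

HB.instance Definition _ :=
  GRing.Zmodule_isLmodule.Build R quotmod qscaleA qscale1 qscaleDr qscaleDl.

Fact qproj_linear : linear qproj.
Proof. by move=> a x y; rewrite qprojD -qscaleE. Qed.
HB.instance Definition _ := GRing.isLinear.Build R _ _ _ qproj qproj_linear.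

End Quotients.

Section QuotientMap.
Variables (R : comPzRingType) (U V : lmodType R).
Variables (S : submodClosed U) (T : submodClosed V) (f : {linear U -> V}).
Hypothesis fST : forall x, x \in S -> f x \in T.

(* The proof argument is only there so that the linear structure can be attached
   to quot_fun fST. *)
Definition quot_fun of (forall x, x \in S -> f x \in T) :=
  fun q : quotmod S => qproj T (f (repr q)).

Lemma quot_funE x : quot_fun fST (qproj S x) = qproj T (f x).
Proof. by apply/qprojP; rewrite -linearB fST //; apply/qprojP/qproj_repr. Qed.

Fact quot_fun_linear : linear (quot_fun fST).
Proof.
move=> a p q; rewrite -[p]qproj_repr -[q]qproj_repr -linearP !quot_funE.
by rewrite !linearP.
Qed.
HB.instance Definition _ :=
  GRing.isLinear.Build R _ _ _ (quot_fun fST) quot_fun_linear.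

Definition quot_map : {linear quotmod S -> quotmod T} := quot_fun fST.
End QuotientMap.

Section KernelCokernel.
Variables (R : comPzRingType) (U V : lmodType R) (f : {linear U -> V}).

Definition in_ker : {pred U} := fun x => f x == 0.
Definition in_im : {pred V} := fun y => `[< exists x, f x = y >].

Fact in_ker_closed : GRing.subsemimod_closed in_ker.
Proof.
split=> [|a x /eqP fx0]; last first.
  by rewrite unfold_in /in_ker linearZ_LR fx0 scaler0.
split=> [|x y /eqP fx0 /eqP fy0]; rewrite /in_ker unfold_in ?linear0 //.
by rewrite linearD fx0 fy0 addr0.
Qed.
HB.instance Definition _ := GRing.isSubmodClosed.Build R U in_ker in_ker_closed.

Fact in_im_closed : GRing.subsemimod_closed in_im.
Proof.
split=> [|a _ /asboolP[x <-]]; last first.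
  by apply/asboolP; exists (a *: x); rewrite linearZ.
split=> [|_ _ /asboolP[x <-] /asboolP[y <-]]; apply/asboolP.
  by exists 0; rewrite linear0.
by exists (x + y); rewrite linearD.
Qed.
HB.instance Definition _ := GRing.isSubmodClosed.Build R V in_im in_im_closed.

Definition Ker : lmodType R := submod in_ker.
Definition Coker : lmodType R := quotmod in_im.
End KernelCokernel.

Section Products.
Variables (R : comPzRingType) (V : nat -> lmodType R).

Definition dprod := forall k, V k.
Implicit Types x y z : dprod.

Lemma dprod_ext x y : (forall k, x k = y k) -> x = y.
Proof. exact: functional_extensionality_dep. Qed.

HB.instance Definition _ := gen_eqMixin dprod.
HB.instance Definition _ := gen_choiceMixin dprod.

Let pzero : dprod := fun=> 0.
Let popp x : dprod := fun k => - x k.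
Let padd x y : dprod := fun k => x k + y k.
Let pscale a x : dprod := fun k => a *: x k.

Fact paddA : associative padd.
Proof. by move=> x y z; apply: dprod_ext => k; exact: addrA. Qed.
Fact paddC : commutative padd.
Proof. by move=> x y; apply: dprod_ext => k; exact: addrC. Qed.
Fact padd0 : left_id pzero padd.
Proof. by move=> x; apply: dprod_ext => k; exact: add0r. Qed.
Fact paddN : left_inverse pzero popp padd.
Proof. by move=> x; apply: dprod_ext => k; exact: addNr. Qed.

HB.instance Definition _ := GRing.isZmodule.Build dprod paddA paddC padd0 paddN.

Fact pscaleA a b x : pscale a (pscale b x) = pscale (a * b) x.
Proof. by apply: dprod_ext => k; exact: scalerA. Qed.
Fact pscale1 : left_id 1 pscale.
Proof. by move=> x; apply: dprod_ext => k; exact: scale1r. Qed.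
Fact pscaleDr : right_distributive pscale +%R.
Proof. by move=> a x y; apply: dprod_ext => k; exact: scalerDr. Qed.
Fact pscaleDl x : {morph pscale^~ x : a b / a + b}.
Proof. by move=> a b; apply: dprod_ext => k; exact: scalerDl. Qed.

HB.instance Definition _ :=
  GRing.Zmodule_isLmodule.Build R dprod pscaleA pscale1 pscaleDr pscaleDl.

Lemma dprod0E k : (0 : dprod) k = 0. Proof. by []. Qed.
Lemma dprodDE x y k : (x + y) k = x k + y k. Proof. by []. Qed.
Lemma dprodZE a x k : (a *: x) k = a *: x k. Proof. by []. Qed.
Lemma dprodBE x y k : (x - y) k = x k - y k. Proof. by []. Qed.

(* The direct sum, as the finitely supported families. *)
Definition fin_supp : {pred dprod} :=
  fun x => `[< exists N, forall k, (N <= k)%N -> x k = 0 >].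

Fact fin_supp_closed : GRing.subsemimod_closed fin_supp.
Proof.
split=> [|a x /asboolP[N xN]]; last first.
  by apply/asboolP; exists N => k /xN xk; rewrite dprodZE xk scaler0.
split=> [|x y /asboolP[N xN] /asboolP[N' yN]]; apply/asboolP.
  by exists 0%N.
exists (maxn N N') => k; rewrite geq_max => /andP[/xN xk /yN yk].
by rewrite dprodDE xk yk addr0.
Qed.
HB.instance Definition _ :=
  GRing.isSubmodClosed.Build R dprod fin_supp fin_supp_closed.

Definition dsum := submod fin_supp.
HB.instance Definition _ := GRing.SubLmodule.on dsum.
End Products.
Arguments fin_supp {R} V _.

Section SubmoduleMap.
Variables (R : comPzRingType) (U V : lmodType R).
Variables (S : submodClosed U) (T : submodClosed V) (f : {linear U -> V}).
Hypothesis fST : forall x, x \in S -> f x \in T.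

Definition submod_fun of (forall x, x \in S -> f x \in T) :=
  fun x : submod S => (Sub (f (val x)) (fST (valP x)) : submod T).

Fact submod_fun_linear : linear (submod_fun fST).
Proof. by move=> a x y; apply: val_inj; rewrite /= linearP. Qed.
HB.instance Definition _ :=
  GRing.isLinear.Build R _ _ _ (submod_fun fST) submod_fun_linear.

Definition submod_map : {linear submod S -> submod T} := submod_fun fST.
End SubmoduleMap.

Section ProductMap.
Variables (R : comPzRingType) (V W : nat -> lmodType R).
Variable f : forall k, {linear V k -> W k}.

Definition dprod_fun (x : dprod V) : dprod W := fun k => f k (x k).

Fact dprod_fun_linear : linear dprod_fun.
Proof.
by move=> a x y; apply: dprod_ext => k;
  rewrite /dprod_fun !(dprodDE, dprodZE) linearP.
Qed.
HB.instance Definition _ :=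
  GRing.isLinear.Build R _ _ _ dprod_fun dprod_fun_linear.

Definition dprod_map : {linear dprod V -> dprod W} := dprod_fun.

Fact dprod_map_fin_supp x : x \in fin_supp V -> dprod_map x \in fin_supp W.
Proof.
move=> /asboolP[N xN]; apply/asboolP; exists N => k /xN xk.
by have := linear0 (f k); rewrite -xk.
Qed.

Definition dsum_map : {linear dsum V -> dsum W} :=
  submod_map dprod_map_fin_supp.
End ProductMap.

Section InverseLimit.
Variables (R : comPzRingType) (V : nat -> lmodType R).
Variable p : forall k, {linear V k.+1 -> V k}.

Definition coherent : {pred dprod V} :=
  fun x => `[< forall k, p k (x k.+1) = x k >].

Fact coherent_closed : GRing.subsemimod_closed coherent.
Proof.
split=> [|a x /asboolP xP]; last first.
  by apply/asboolP => k; rewrite !dprodZE linearZ_LR xP.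
split=> [|x y /asboolP xP /asboolP yP]; apply/asboolP => k.
  by rewrite !dprod0E linear0.
by rewrite !dprodDE linearD xP yP.
Qed.
HB.instance Definition _ :=
  GRing.isSubmodClosed.Build R (dprod V) coherent coherent_closed.

Definition invlim : lmodType R := submod coherent.
End InverseLimit.

Section InverseLimitMap.
Variables (R : comPzRingType) (V W : nat -> lmodType R).
Variables (p : forall k, {linear V k.+1 -> V k})
          (q : forall k, {linear W k.+1 -> W k}).
Variable f : forall k, {linear V k -> W k}.
Hypothesis fpq : forall k x, f k (p k x) = q k (f k.+1 x).

Fact dprod_map_coherent x : x \in coherent p -> dprod_map f x \in coherent q.
Proof.
move=> /asboolP xP; apply/asboolP => k.
by have := fpq (x k.+1); rewrite xP => fE; exact: esym fE.
Qed.

Definition invlim_map : {linear invlim p -> invlim q} :=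
  submod_map dprod_map_coherent.
End InverseLimitMap.

Section DirectLimit.
Variables (R : comPzRingType) (V : nat -> lmodType R).
Variable t : forall k, {linear V k -> V k.+1}.

Definition shift_fun (x : dprod V) : dprod V :=
  fun k => if k is j.+1 return V k then t j (x j) else 0.

Fact shift_fun_linear : linear shift_fun.
Proof.
move=> a x y; apply: dprod_ext => -[|k] /=.
  by rewrite dprodDE dprodZE /= scaler0 addr0.
by rewrite !(dprodDE, dprodZE) /= linearP.
Qed.
HB.instance Definition _ :=
  GRing.isLinear.Build R _ _ _ shift_fun shift_fun_linear.

Fact shift_fin_supp x : x \in fin_supp V -> shift_fun x \in fin_supp V.
Proof.
move=> /asboolP[N xN]; apply/asboolP; exists N.+1 => -[|k] //= Nk.
by rewrite xN // linear0.
Qed.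

Definition dsum_shift : {linear dsum V -> dsum V} := submod_map shift_fin_supp.

(* The colimit of V 0 -> V 1 -> ... : the direct sum modulo the identifications
   of x in V k with t k x in V k.+1. *)
Definition dirlim : lmodType R := Coker (idfun \- dsum_shift).
End DirectLimit.

Section DirectLimitMap.
Variables (R : comPzRingType) (V W : nat -> lmodType R).
Variables (s : forall k, {linear V k -> V k.+1})
          (t : forall k, {linear W k -> W k.+1}).
Variable f : forall k, {linear V k -> W k}.
Hypothesis fst : forall k x, f k.+1 (s k x) = t k (f k x).

Fact dsum_map_shift x :
  dsum_map f (dsum_shift s x) = dsum_shift t (dsum_map f x).
Proof.
apply: val_inj; apply: dprod_ext => -[|k] /=.
  exact: linear0 (f 0%N).
exact: fst.
Qed.

Fact dsum_map_telescope x : x \in in_im (idfun \- dsum_shift s) ->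
  dsum_map f x \in in_im (idfun \- dsum_shift t).
Proof.
move=> /asboolP[y <-]; apply/asboolP; exists (dsum_map f y).
by rewrite /= linearB /= -dsum_map_shift.
Qed.

Definition dirlim_map : {linear dirlim s -> dirlim t} :=
  quot_map dsum_map_telescope.
End DirectLimitMap.

Section IdealTimesSubmodule.
Variables (R : comPzRingType) (V : lmodType R) (J : {pred R}).

(* J N, the finite sums of products a x with a in J and x in N. *)
Definition mulim (N : {pred V}) : {pred V} := fun x =>
  `[< exists2 s : seq (R * V),
        forall p, p \in s -> p.1 \in J /\ p.2 \in N &
        x = \sum_(p <- s) p.1 *: p.2 >].

Fact mulim_closed N :
  GRing.subsemimod_closed N -> GRing.subsemimod_closed (mulim N).
Proof.
move=> [_ NZ]; split=> [|a _ /asboolP[s sJN ->]]; last first.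
  apply/asboolP; exists [seq (p.1, a *: p.2) | p <- s].
    by move=> _ /mapP[p /sJN[pJ pN] ->]; split=> //; exact: NZ.
  rewrite big_map scaler_sumr; apply: eq_bigr => p _ /=.
  by rewrite !scalerA mulrC.
split=> [|_ _ /asboolP[s sJN ->] /asboolP[s' sJN' ->]]; apply/asboolP.
  by exists [::] => //; rewrite big_nil.
exists (s ++ s'); last by rewrite big_cat.
by move=> p; rewrite mem_cat => /orP[/sJN|/sJN'].
Qed.

HB.instance Definition _ (N : submodClosed V) :=
  GRing.isSubmodClosed.Build R V (mulim N)
    (mulim_closed (GRing.subsemimodClosedP N)).

Lemma mulim_sub (N : submodClosed V) x : x \in mulim N -> x \in N.
Proof.
move=> /asboolP[s sJN ->]; rewrite big_seq; apply: rpred_sum => p /sJN[_ pN].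
exact: rpredZ.
Qed.

Definition all_mod : {pred V} := predT.
Fact all_mod_closed : GRing.subsemimod_closed all_mod. Proof. by []. Qed.
HB.instance Definition _ :=
  GRing.isSubmodClosed.Build R V all_mod all_mod_closed.
End IdealTimesSubmodule.
Arguments all_mod {R} V _.

(* An ideal of R is a submodule of R^o. Its boolean membership predicate is no
   restriction: every Prop-valued predicate is reflected by one (asbool). *)
Section IdealPowers.
Variables (R : comPzRingType) (I : submodClosed R^o).

Fixpoint ideal_exp (k : nat) : {pred R^o} :=
  if k is j.+1 then mulim I (ideal_exp j) else all_mod R^o.

Fact ideal_exp_closed k : GRing.subsemimod_closed (ideal_exp k).
Proof.
elim: k => [|k IHk]; [exact: GRing.subsemimodClosedP | exact: mulim_closed].
Qed.
HB.instance Definition _ k :=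
  GRing.isSubmodClosed.Build R R^o (ideal_exp k) (ideal_exp_closed k).

Lemma ideal_exp_sub k x : x \in ideal_exp k.+1 -> x \in ideal_exp k.
Proof. exact: (@mulim_sub R R^o I (ideal_exp k)). Qed.

Definition exp_mod (V : lmodType R) (k : nat) : {pred V} :=
  mulim (ideal_exp k) (all_mod V).
Arguments exp_mod V k _ : clear implicits.
HB.instance Definition _ (V : lmodType R) k :=
  GRing.isSubmodClosed.Build R V (exp_mod V k)
    (mulim_closed (ideal_exp k) (GRing.subsemimodClosedP (all_mod V))).

Lemma exp_mod_sub (V : lmodType R) k x :
  x \in exp_mod V k.+1 -> x \in exp_mod V k.
Proof.
move=> /asboolP[s sI ->]; apply/asboolP; exists s => // p /sI[pI _].
by split=> //; exact: ideal_exp_sub.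
Qed.

Lemma exp_mod_map (V W : lmodType R) (f : {linear V -> W}) k x :
  x \in exp_mod V k -> f x \in exp_mod W k.
Proof.
move=> /asboolP[s sI ->]; apply/asboolP; exists [seq (p.1, f p.2) | p <- s].
  by move=> _ /mapP[p /sI[pI _] ->].
by rewrite big_map linear_sum; apply: eq_bigr => p _; rewrite linearZ.
Qed.

End IdealPowers.
Arguments exp_mod {R} I V k _.

Section TorsionFunctor.
Variables (R : comPzRingType) (I : submodClosed R^o).

Definition ring_quot (k : nat) : lmodType R := quotmod (ideal_exp I k).

Definition ring_quot_tr (k : nat) : {linear ring_quot k.+1 -> ring_quot k} :=
  quot_map (f := idfun) (@ideal_exp_sub R I k).

Definition Gamma_diag (M : lmodType R) (k : nat) : lmodType R :=
  {linear ring_quot k -> M}.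

Definition Gamma_tr (M : lmodType R) (k : nat) :
    {linear Gamma_diag M k -> Gamma_diag M k.+1} :=
  precomp (ring_quot_tr k).

Definition Gamma_obj (M : lmodType R) : lmodType R := dirlim (Gamma_tr M).

Definition Gamma_level (M N : lmodType R) (f : {linear M -> N}) (k : nat) :
    {linear Gamma_diag M k -> Gamma_diag N k} :=
  postcomp f.

Fact Gamma_tr_natural (M N : lmodType R) (f : {linear M -> N}) k
    (x : Gamma_diag M k) :
  Gamma_level f k.+1 (Gamma_tr M k x) = Gamma_tr N k (Gamma_level f k x).
Proof. exact: linear_ext. Qed.

Definition Gamma_map (M N : lmodType R) (f : {linear M -> N}) :
    {linear Gamma_obj M -> Gamma_obj N} :=
  dirlim_map (Gamma_tr_natural f).

Fact Gamma_id (M : lmodType R) : Gamma_map (idm (M : Mod R)) = idfun.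
Proof.
apply: linear_ext => q; rewrite -[q]qproj_repr [LHS]quot_funE.
congr (qproj _ _); apply: val_inj; apply: dprod_ext => k.
exact: linear_ext.
Qed.

Fact Gamma_comp (M N P : lmodType R) (g : {linear N -> P})
    (f : {linear M -> N}) :
  Gamma_map (g \o f) = Gamma_map g \o Gamma_map f :> {linear _ -> _}.
Proof.
apply: linear_ext => q; rewrite -[q]qproj_repr [LHS]quot_funE /=.
rewrite quot_funE qproj_repr.
congr (qproj _ _); apply: val_inj; apply: dprod_ext => k.
exact: linear_ext.
Qed.

Definition Gamma : functor (Mod R) (Mod R) :=
  @Functor (Mod R) (Mod R) Gamma_obj Gamma_map Gamma_id Gamma_comp.
End TorsionFunctor.

Section CompletionFunctor.
Variables (R : comPzRingType) (I : submodClosed R^o).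

Definition Lambda_diag (M : lmodType R) (k : nat) : lmodType R :=
  quotmod (exp_mod I M k).

Definition Lambda_tr (M : lmodType R) (k : nat) :
    {linear Lambda_diag M k.+1 -> Lambda_diag M k} :=
  quot_map (f := idfun) (@exp_mod_sub R I M k).

Definition Lambda_obj (M : lmodType R) : lmodType R := invlim (Lambda_tr M).

Definition Lambda_level (M N : lmodType R) (f : {linear M -> N}) (k : nat) :
    {linear Lambda_diag M k -> Lambda_diag N k} :=
  quot_map (@exp_mod_map R I M N f k).

Fact Lambda_tr_natural (M N : lmodType R) (f : {linear M -> N}) k
    (x : Lambda_diag M k.+1) :
  Lambda_level f k (Lambda_tr M k x) = Lambda_tr N k (Lambda_level f k.+1 x).
Proof. by rewrite -[x]qproj_repr /= !quot_funE. Qed.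

Definition Lambda_map (M N : lmodType R) (f : {linear M -> N}) :
    {linear Lambda_obj M -> Lambda_obj N} :=
  invlim_map (Lambda_tr_natural f).

Fact Lambda_id (M : lmodType R) : Lambda_map (idm (M : Mod R)) = idfun.
Proof.
apply: linear_ext => x; apply: val_inj.
apply: dprod_ext => k.
by rewrite /= /dprod_fun /= -[RHS]qproj_repr.
Qed.

Fact Lambda_comp (M N P : lmodType R) (g : {linear N -> P})
    (f : {linear M -> N}) :
  Lambda_map (g \o f) = Lambda_map g \o Lambda_map f :> {linear _ -> _}.
Proof.
apply: linear_ext => x; apply: val_inj.
apply: dprod_ext => k.
exact/esym/quot_funE.
Qed.

Definition Lambda : functor (Mod R) (Mod R) :=
  @Functor (Mod R) (Mod R) Lambda_obj Lambda_map Lambda_id Lambda_comp.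
End CompletionFunctor.

Section Subcategories.
Variables (R : comPzRingType) (I : submodClosed R^o).
Implicit Types M : lmodType R.

Definition homothety M (a : R) : {linear M -> M} := *:%R a.

Definition reduced M : Prop := forall a, a \in I ->
  isomorphic (Ker (homothety M a)) (Ker (homothety M a \o homothety M a)).

Definition coreduced M : Prop := forall a, a \in I ->
  isomorphic (Coker (homothety M a)) (Coker (homothety M a \o homothety M a)).

Definition torsion M : Prop := isomorphic (Gamma I M) M.

Definition complete M : Prop := isomorphic (Lambda I M) M.

Definition in_E M : Prop := complete M /\ coreduced M.

Definition in_D M : Prop := torsion M /\ reduced M.
End Subcategories.

(* Main.v *)
From HB Require Import structures.
From mathcomp Require Import all_boot all_algebra.
From mathcomp Require Import boolp.
Require Import Defs.

Set Implicit Arguments.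
Unset Strict Implicit.
Unset Printing Implicit Defensive.

Import GRing.Theory.
Local Open Scope ring_scope.

(** Everything is governed by one condition on a module M, namely I M = 0
(called [killed I M] below): both subcategories of the theorem, in_D and
in_E, consist exactly of the modules killed by I, and on these modules both
functors are naturally isomorphic to the identity.

If M is reduced, then a m = 0 as soon as some power of a kills m. An element
of Gamma_I(M) is represented by homomorphisms R/I^k -> M, whose values are
killed by I^k, hence by a^k, hence by a, for every a in I; so I kills
Gamma_I(M) ([reduced_Gamma_killed]). If M is coreduced, then a M = a^k (a M),
which lies in I^k M, for every k and every a in I; so a acts as zero on every
M/I^k M, and I kills Lambda_I(M) ([coreduced_Lambda_killed]). If I is
idempotent, then I is contained in every I^k and both conclusions hold for
arbitrary M.

Annihilators do not change under isomorphism. Hence an abstract isomorphism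
of Gamma_I(M) or of Lambda_I(M) with M is enough to transfer I M = 0 to M,
and the abstract isomorphisms in the definitions of reduced and coreduced
force the natural inclusion and projection to be bijective ([reducedP],
[coreducedP]).

Conversely, let I M = 0. Sending m to the homomorphism r |-> r m on R/I gives
a natural isomorphism M -> Gamma_I(M) ([Gamma_unit_bij]), and the projections
M -> M/I^k M give one from M to Lambda_I(M) ([Lambda_unit_bij]). So M is
torsion, complete, reduced and coreduced, and composing the two natural
isomorphisms shows that Gamma_I and Lambda_I are quasi-inverse. When I is
idempotent, the complete modules and the torsion modules are both the modules
killed by I, so the two subcategories have the same objects. *)

(** * Isomorphisms of modules and of functors *)

Lemma inj_surj_bij (T U : Type) (f : T -> U) :
  injective f -> (forall y, exists x, f x = y) -> bijective f.
Proof. by move=> f_inj /choice[g gK]; exists g => // x; exact/f_inj/gK. Qed.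

Section Isomorphisms.
Variable R : comPzRingType.

Lemma linear_inverse (U V : lmodType R) (f : {linear U -> V}) :
  bijective f -> exists2 g : {linear V -> U}, cancel f g & cancel g f.
Proof.
case=> g fK gK.
have gL : linear g.
  by move=> a x y; apply: (can_inj fK); rewrite linearP !gK.
pose gM := GRing.isLinear.Build R V U *:%R g gL.
by exists (HB.pack g gM : {linear V -> U}).
Qed.

Lemma isomorphic_sym (U V : lmodType R) : isomorphic U V -> isomorphic V U.
Proof. by case=> f /linear_inverse[g fK gK]; exists g; exists f. Qed.

(** Annihilators are isomorphism invariants; this is how an abstract
isomorphism between modules yields information on each of them. *)
Lemma isomorphic_scale0 (U V : lmodType R) (a : R) : isomorphic U V ->
  (forall x : U, a *: x = 0) -> forall y : V, a *: y = 0.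
Proof. by case=> f [g _ gK] aU0 y; rewrite -[y]gK -linearZ aU0 linear0. Qed.

Lemma isomorphic_eq_pred (V : lmodType R) (S T : submodClosed V) :
  S =i T -> isomorphic (submod S) (submod T) /\ isomorphic (quotmod S) (quotmod T).
Proof.
move=> ST.
have st x : x \in S -> idfun x \in T by rewrite ST.
have ts x : x \in T -> idfun x \in S by rewrite ST.
split.
  by exists (submod_map st); exists (submod_map ts) => x; exact: val_inj.
by exists (quot_map st); exists (quot_map ts) => x;
  rewrite -[x]qproj_repr /= !quot_funE.
Qed.

Lemma qproj0P (V : lmodType R) (S : submodClosed V) (x : V) :
  qproj S x = 0 <-> x \in S.
Proof.
by rewrite -(linear0 (qproj S)); split=> [/qprojP|xS];
  [|apply/qprojP]; rewrite subr0.
Qed.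

Lemma quotmod_scale0 (V : lmodType R) (S : submodClosed V) (a : R) :
  (forall x, a *: x \in S) -> forall q : quotmod S, a *: q = 0.
Proof. by move=> aVS q; rewrite -[q]qproj_repr -linearZ; exact/qproj0P. Qed.

End Isomorphisms.

(** The inverses of the components of eta are chosen; naturality of the
resulting family follows from that of eta. *)
Lemma nat_iso_from_id (C : category) (F : functor C C)
    (eta : forall x, hom x (F x)) :
    (forall x y (f : hom x y), comp (eta y) f = comp (fmap F f) (eta x)) ->
    (forall x, exists2 g, comp g (eta x) = idm x & comp (eta x) g = idm (F x)) ->
  inhabited (nat_iso F (id_functor C)).
Proof.
move=> etaN /(_ _)/cid2 etaV; pose g x := s2val (etaV x).
have gK x : comp (g x) (eta x) = idm x := s2valP (etaV x).
have etaK x : comp (eta x) (g x) = idm (F x) := s2valP' (etaV x).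
split; apply: (@NatIso _ _ F (id_functor C) g eta) => // x y f.
rewrite -[LHS]comp_idr -(etaK x) compA -(compA (g y)) -etaN compA.
by rewrite (gK y) comp_idl.
Qed.

(** * Reduced and coreduced modules *)

Section Killed.
Variables (R : comPzRingType) (I : submodClosed R^o).
Implicit Types M : lmodType R.

Definition killed M : Prop := forall a, a \in I -> forall m : M, a *: m = 0.

Lemma killed_isomorphic (M N : lmodType R) :
  isomorphic M N -> killed M -> killed N.
Proof. by move=> MN M0 a /M0; exact: isomorphic_scale0. Qed.

(** An abstract isomorphism of the two kernels suffices: a kills Ker f_a, hence
also Ker f_a^2, which is therefore contained in Ker f_a. *)
Lemma reducedP M : reduced I M <->
  forall a, a \in I -> forall m : M, a *: (a *: m) = 0 -> a *: m = 0.
Proof.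
split=> [redM a aI m aam0|redM a aI].
  have aK0 (x : Ker (homothety M a)) : a *: x = 0.
    by apply: val_inj; rewrite linearZ; exact/eqP/(valP x).
  have kerm : m \in in_ker (homothety M a \o homothety M a) by exact/eqP.
  have := isomorphic_scale0 (redM a aI) aK0 (Sub m kerm).
  by move=> /(congr1 val).
apply: (proj1 (isomorphic_eq_pred _)) => m.
apply/eqP/eqP => /= [am0|]; last exact: redM.
by have /= -> := am0; rewrite linear0.
Qed.

(** Dually to [reducedP], a kills the cokernel M/aM, hence also M/a^2 M, so
that a M is contained in a^2 M. *)
Lemma coreducedP M : coreduced I M <->
  forall a, a \in I -> forall m : M, exists n, a *: m = a *: (a *: n).
Proof.
split=> [corM a aI m|corM a aI].
  have aC0 : forall x : Coker (homothety M a), a *: x = 0.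
    by apply: quotmod_scale0 => x; apply/asboolP; exists x.
  pose S := in_im (homothety M a \o homothety M a).
  have := isomorphic_scale0 (corM a aI) aC0 (qproj S m).
  by rewrite -linearZ => /qproj0P/asboolP[n <-]; exists n.
apply: (proj2 (isomorphic_eq_pred _)) => m.
apply/asboolP/asboolP => -[n <-]; last by exists (a *: n).
by have [n' n'E] := corM a aI n; exists n'.
Qed.

Lemma killed_reduced M : killed M -> reduced I M.
Proof. by move=> M0; apply/reducedP => a aI m _; exact: M0. Qed.

Lemma killed_coreduced M : killed M -> coreduced I M.
Proof. by move=> M0; apply/coreducedP => a aI m; exists 0; rewrite !M0. Qed.

Lemma exp_in_ideal_exp (a : R) k : a \in I -> a ^+ k \in ideal_exp I k.
Proof.
move=> aI; elim: k => [|k IHk] //=; apply/asboolP.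
exists [:: (a, a ^+ k : R^o)]; last by rewrite big_seq1 exprS.
by move=> p; rewrite inE => /eqP ->.
Qed.

Lemma ideal_exp1_sub (r : R) : r \in ideal_exp I 1 -> r \in I.
Proof.
move=> /asboolP[s sI ->]; rewrite big_seq; apply: rpred_sum => p /sI[pI _].
by rewrite [_ *: _]mulrC -[_ * _]/((p.2 : R) *: (p.1 : R^o)) rpredZ.
Qed.

Lemma ideal_expS_sub k (r : R) : r \in ideal_exp I k.+1 -> r \in I.
Proof.
by elim: k => [|k IHk] rI; [exact: ideal_exp1_sub | exact/IHk/ideal_exp_sub].
Qed.

Lemma idempotent_ideal_exp : ideal_exp I 2 =i I ->
  forall k (a : R), a \in I -> a \in ideal_exp I k.
Proof.
move=> I2 k; elim: k => [|[|k] IHk] a aI //.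
  by apply: ideal_exp_sub; rewrite I2.
move: aI; rewrite -I2 => /asboolP[s sI ->]; apply/asboolP; exists s => //.
by move=> p /sI[pI /ideal_exp1_sub/IHk].
Qed.

(** * Modules killed by I and the torsion functor *)

Definition qone (k : nat) : ring_quot I k := qproj (ideal_exp I k) 1.

Section TorsionKilled.
Variable M : lmodType R.

(** The class of 1 generates the R-module R/I^k. *)
Lemma ring_quot_hom_ext k (f g : Gamma_diag I M k) :
  f (qone k) = g (qone k) -> f = g.
Proof.
move=> fg1; apply: linear_ext => q; rewrite -[q]qproj_repr.
have -> : repr q = (repr q : R) *: (1 : R^o).
  by rewrite -[RHS]/((repr q : R) * 1) mulr1.
by rewrite !linearZ fg1.
Qed.

Lemma ring_quot_hom0 (f : Gamma_diag I M 0) : f = 0.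
Proof.
apply: ring_quot_hom_ext; rewrite -[RHS](linear0 f); congr (f _).
exact/qproj0P.
Qed.

Lemma ring_quot_hom_scale k (f : Gamma_diag I M k) (r : R) :
  r \in ideal_exp I k -> r *: f (qone k) = 0.
Proof.
move=> rI; rewrite -linearZ -linearZ -[RHS](linear0 f); congr (f _).
by apply/qproj0P; rewrite -[_ *: _]/(_ * _ : R) mulr1.
Qed.

(** By [ring_quot_hom_ext], a family of homomorphisms R/I^k -> M is determined
by its values at 1; tracking these elements of M replaces working with the
dependent family. *)
Definition value (x : dsum (Gamma_diag I M)) (k : nat) : M :=
  (val x k : Gamma_diag I M k) (qone k).

Lemma value0 x : value x 0 = 0.
Proof. by rewrite /value [val x 0%N]ring_quot_hom0. Qed.

Lemma value_ext x y : (forall k, value x k.+1 = value y k.+1) -> x = y.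
Proof.
move=> xy; apply: val_inj; apply: dprod_ext => k; apply: ring_quot_hom_ext.
by case: k => [|k]; [rewrite [LHS]value0 [RHS]value0 | exact: xy].
Qed.

Lemma valueS_shift x k :
  value ((idfun \- dsum_shift (Gamma_tr I M)) x) k.+1
  = value x k.+1 - value x k.
Proof.
congr (_ - _); rewrite /value /= /precomp /=.
by rewrite quot_funE.
Qed.

(** Since R/I^0 = 0, index 0 contributes nothing ([value0]), and the relation
defining the direct limit becomes a statement on successive differences in
M. *)
Lemma Gamma_class0P (x : dsum (Gamma_diag I M)) :
  qproj (in_im (idfun \- dsum_shift (Gamma_tr I M))) x = 0 <->
  exists y, forall k, value x k.+1 = value y k.+1 - value y k.
Proof.
split=> [/qproj0P/asboolP[y <-]|[y yE]].
  by exists y => k; exact: valueS_shift.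
apply/qproj0P/asboolP; exists y; apply: value_ext => k.
by rewrite valueS_shift yE.
Qed.

(** The values of a homomorphism R/I^k -> M at 1 are the elements killed by
I^k, so only such elements have to be controlled. *)
Lemma Gamma_killed :
    (forall k a (m : M), a \in I ->
       (forall r, r \in ideal_exp I k -> r *: m = 0) -> a *: m = 0) ->
  killed (Gamma I M).
Proof.
move=> tors a aI; apply: quotmod_scale0 => x; suff -> : a *: x = 0 by exact: rpred0.
apply: value_ext => k.
change (a *: value x k.+1 = 0).
by apply: (tors k.+1) => // r; exact: ring_quot_hom_scale.
Qed.

Hypothesis M0 : killed M.

(** The homomorphism r |-> r m on R/I^(k+1). It is well defined because
I^(k+1) is contained in I, which kills M; for R/I^0 = 0 the only homomorphism
is zero, whence the case split in [orbit_hom]. *)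
Definition orbit_fun (k : nat) (m : M) : ring_quot I k.+1 -> M :=
  fun q => (repr q : R) *: m.

Lemma orbit_funE k m (r : R) : orbit_fun m (qproj (ideal_exp I k.+1) r) = r *: m.
Proof.
apply/eqP; rewrite -subr_eq0 -scalerBl; apply/eqP/M0/(@ideal_expS_sub k).
exact/qprojP/qproj_repr.
Qed.

Fact orbit_fun_linear k m : linear (@orbit_fun k m).
Proof.
move=> a p q; rewrite -[p]qproj_repr -[q]qproj_repr -linearP !orbit_funE.
by rewrite scalerDl -scalerA.
Qed.
HB.instance Definition _ k m :=
  GRing.isLinear.Build R _ _ _ (@orbit_fun k m) (@orbit_fun_linear k m).

Definition orbit_hom (k : nat) (m : M) : Gamma_diag I M k :=
  if k is j.+1 return Gamma_diag I M k then @orbit_fun j m else 0.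

Lemma orbit_homE k m : orbit_hom k.+1 m (qone k.+1) = m.
Proof. by rewrite /orbit_hom /= orbit_funE scale1r. Qed.

Lemma orbit_hom_linear k : linear (orbit_hom k).
Proof.
case: k => [|k] a m n; first by rewrite [LHS]ring_quot_hom0 [RHS]ring_quot_hom0.
by apply: ring_quot_hom_ext => /=; rewrite !orbit_funE !scale1r.
Qed.
HB.instance Definition _ k :=
  GRing.isLinear.Build R _ _ _ (orbit_hom k) (orbit_hom_linear k).

Fact orbit1_fin_supp m :
  (fun k => if k == 1%N then orbit_hom k m else 0) \in fin_supp (Gamma_diag I M).
Proof. by apply/asboolP; exists 2%N => -[|[]]. Qed.

(** The element m is represented by r |-> r m at level 1, the first level where
this homomorphism exists. The proof argument is what lets the linear structure,
which depends on it, be attached to [Gamma_unit_fun M0]. *)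
Definition Gamma_unit_fun of killed M : M -> Gamma I M := fun m =>
  qproj _ (Sub (_ : dprod _) (orbit1_fin_supp m) : dsum (Gamma_diag I M)).

Lemma value_orbit1 m k :
  value (Sub (_ : dprod _) (orbit1_fin_supp m) : dsum (Gamma_diag I M)) k.+1 =
  if k == 0%N then m else 0.
Proof. by case: k => [|k] //; exact: orbit_homE. Qed.

Fact Gamma_unit_linear : linear (Gamma_unit_fun M0).
Proof.
move=> a m n; rewrite /Gamma_unit_fun -linearP; congr (qproj _ _).
apply: value_ext => k; rewrite value_orbit1.
rewrite [RHS]/value linearP; change ((if k == 0%N then a *: m + n else 0) =
  a *: value (Sub (_ : dprod _) (orbit1_fin_supp m)) k.+1
  + value (Sub (_ : dprod _) (orbit1_fin_supp n)) k.+1).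
by rewrite !value_orbit1; case: ifP => _ //; rewrite scaler0 addr0.
Qed.
HB.instance Definition _ :=
  GRing.isLinear.Build R _ _ _ (Gamma_unit_fun M0) Gamma_unit_linear.

Definition Gamma_unit : {linear M -> Gamma I M} := Gamma_unit_fun M0.

(** If the class of m vanishes, the telescoping relation produces a family whose
values at all levels k > 0 are m; finite support then forces m = 0. *)
Lemma Gamma_unit_inj : injective Gamma_unit.
Proof.
apply: raddf_inj => m /Gamma_class0P[y yE].
have yk k : value y k.+1 = m.
  elim: k => [|k IHk].
    by have := yE 0%N; rewrite value_orbit1 value0 subr0.
  have /esym/eqP := yE k.+1.
  by rewrite value_orbit1 subr_eq0 IHk => /eqP.
have /asboolP[N yN] := valP y.
by rewrite -(yk N) /value yN.
Qed.

(** The class of a family x is the image of the sum of all its values: the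
difference telescopes along the partial sums of these values. *)
Lemma Gamma_unit_surj q : exists m, Gamma_unit m = q.
Proof.
rewrite -[q]qproj_repr; set x := repr q.
have /asboolP[N xN] := valP x.
pose S k := \sum_(0 <= j < k) value x j.
have SN k : (N <= k)%N -> S k = S N.
  move=> Nk; rewrite /S (@big_cat_nat _ _ _ N) //= [X in _ + X]big_nat.
  rewrite [X in _ + X]big1 ?addr0 // => j /andP[Nj _].
  by rewrite /value xN.
(* Subtracting the total sum S N makes the partial sums eventually zero,
   as required for finite support. *)
pose y : dprod (Gamma_diag I M) := fun k => orbit_hom k (S k.+1 - S N).
have yfin : y \in fin_supp (Gamma_diag I M).
  by apply/asboolP; exists N => k Nk; rewrite /y SN ?leqW // subrr linear0.
exists (S N); apply/eqP; rewrite eq_sym -subr_eq0 -[X in _ - X]/(qproj _ _).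
rewrite -linearB; apply/eqP/Gamma_class0P; exists (Sub y yfin) => k.
rewrite {1}/value linearB.
change (value x k.+1 -
  value (Sub (_ : dprod _) (orbit1_fin_supp (S N))) k.+1 =
  y k.+1 (qone k.+1) - y k (qone k)).
rewrite value_orbit1 orbit_homE; case: k => [|k].
  rewrite -[y 0%N _]/(0 : M) subr0 /S; congr (_ - _).
  by rewrite !big_nat_recr //= big_nil value0 !add0r.
rewrite subr0 orbit_homE opprB addrA subrK /S [in RHS]big_nat_recr //=.
by rewrite addrAC subrr add0r.
Qed.

Lemma Gamma_unit_bij : bijective Gamma_unit.
Proof. exact: inj_surj_bij Gamma_unit_inj Gamma_unit_surj. Qed.

End TorsionKilled.

Lemma Gamma_unit_natural (M N : lmodType R) (M0 : killed M) (N0 : killed N)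
    (f : {linear M -> N}) m :
  Gamma_unit N0 (f m) = Gamma_map I f (Gamma_unit M0 m).
Proof.
rewrite [RHS]quot_funE; congr (qproj _ _); apply: value_ext => k.
change (value (Sub (_ : dprod _) (orbit1_fin_supp N0 (f m))) k.+1 =
  f (value (Sub (_ : dprod _) (orbit1_fin_supp M0 m)) k.+1)).
by rewrite !value_orbit1; case: ifP; rewrite ?linear0.
Qed.

(** * Modules killed by I and the completion functor *)

Section CompletionKilled.
Variable M : lmodType R.

Lemma Lambda_killed :
    (forall k a (m : M), a \in I -> a *: m \in exp_mod I M k) ->
  killed (Lambda I M).
Proof.
move=> div a aI x; apply: val_inj; apply: dprod_ext => k.
exact: (@quotmod_scale0 _ _ (exp_mod I M k) a (fun m => div k a m aI) (val x k)).
Qed.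

Definition Lambda_unit_fam (m : M) : dprod (Lambda_diag I M) :=
  fun k => qproj (exp_mod I M k) m.

Fact Lambda_unit_coherent m : Lambda_unit_fam m \in coherent (Lambda_tr I M).
Proof. by apply/asboolP => k; rewrite /= quot_funE. Qed.

Definition Lambda_unit_fun : M -> Lambda I M := fun m =>
  Sub (Lambda_unit_fam m) (Lambda_unit_coherent m).

Fact Lambda_unit_linear : linear Lambda_unit_fun.
Proof.
move=> a m n; apply: val_inj; apply: dprod_ext => k.
exact: (linearP (qproj (exp_mod I M k))).
Qed.
HB.instance Definition _ :=
  GRing.isLinear.Build R _ _ _ Lambda_unit_fun Lambda_unit_linear.

Definition Lambda_unit : {linear M -> Lambda I M} := Lambda_unit_fun.

Hypothesis M0 : killed M.

Lemma killed_exp_mod0 k (m : M) : m \in exp_mod I M k.+1 -> m = 0.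
Proof.
move=> /asboolP[s sI ->]; rewrite big_seq big1 // => p /sI[pI _].
exact/M0/(ideal_expS_sub pI).
Qed.

Lemma Lambda_unit_inj : injective Lambda_unit.
Proof.
move=> m n /(congr1 (fun x => val x 1%N : Lambda_diag I M 1)) /qprojP.
by move=> /killed_exp_mod0/eqP; rewrite subr_eq0 => /eqP.
Qed.

(** All levels k > 0 of the tower are M itself, so a coherent family is
determined by its component at level 1. *)
Lemma Lambda_unit_surj x : exists m, Lambda_unit m = x.
Proof.
pose c k : quotmod (exp_mod I M k) := val x k.
have cS k : Lambda_tr I M k (c k.+1) = c k by exact: (elimT (asboolP _) (valP x)).
exists (repr (c 1%N)); apply: val_inj; apply: dprod_ext => k.
change (qproj (exp_mod I M k) (repr (c 1%N)) = c k).
have trE j (q : quotmod (exp_mod I M j.+1)) :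
    Lambda_tr I M j q = qproj (exp_mod I M j) (repr q).
  by rewrite -{1}[q]qproj_repr [LHS]quot_funE.
case: k => [|k]; first by rewrite -(cS 0%N) trE.
elim: k => [|k IHk]; first exact: qproj_repr.
rewrite -[RHS]qproj_repr; congr (qproj _ _).
move: IHk; rewrite -(cS k.+1) trE => /(qprojP _ _).
by move=> /killed_exp_mod0/eqP; rewrite subr_eq0 => /eqP.
Qed.

Lemma Lambda_unit_bij : bijective Lambda_unit.
Proof. exact: inj_surj_bij Lambda_unit_inj Lambda_unit_surj. Qed.

End CompletionKilled.

Lemma Lambda_unit_natural (M N : lmodType R) (f : {linear M -> N}) m :
  Lambda_unit N (f m) = Lambda_map I f (Lambda_unit M m).
Proof.
apply: val_inj; apply: dprod_ext => k.
exact/esym/quot_funE.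
Qed.

(** * The categories of the theorem are those of modules killed by I *)

Lemma reduced_Gamma_killed M : reduced I M -> killed (Gamma I M).
Proof.
move=> /reducedP redM; apply: Gamma_killed => k a m aI km0.
have := km0 _ (exp_in_ideal_exp k aI); elim: k {km0} => [|[|k] IHk].
- by rewrite scale1r => ->; rewrite scaler0.
- by rewrite expr1.
by rewrite !exprS -!scalerA => /(redM _ aI); rewrite scalerA -exprS => /IHk.
Qed.

Lemma coreduced_Lambda_killed M : coreduced I M -> killed (Lambda I M).
Proof.
move=> /coreducedP corM; apply: Lambda_killed => k a m aI.
(* The extra factor a on the right is what coreducedness acts on at the
   next step. *)
have [n ->] : exists n, a *: m = a ^+ k *: (a *: n).
  elim: k => [|k [n ->]]; first by exists m; rewrite scale1r.
  by have [n' ->] := corM a aI n; exists n'; rewrite scalerA -exprSr.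
apply/asboolP; exists [:: (a ^+ k, a *: n)]; last by rewrite big_seq1.
by move=> p; rewrite inE => /eqP -> /=; split=> //; exact: exp_in_ideal_exp.
Qed.

(** Idempotence makes I contained in I^k, so I^k m = 0 gives I m = 0. *)
Lemma idempotent_Gamma_killed M : ideal_exp I 2 =i I -> killed (Gamma I M).
Proof.
move=> I2; apply: Gamma_killed => k a m aI km0.
exact/km0/idempotent_ideal_exp.
Qed.

Lemma idempotent_Lambda_killed M : ideal_exp I 2 =i I -> killed (Lambda I M).
Proof.
move=> I2; apply: Lambda_killed => k a m aI.
apply/asboolP; exists [:: (a, m)]; last by rewrite big_seq1.
by move=> p; rewrite inE => /eqP -> /=; split=> //; exact: idempotent_ideal_exp.
Qed.

Lemma killed_torsion M : killed M -> torsion I M.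
Proof.
move=> M0; apply: isomorphic_sym.
by exists (Gamma_unit M0); exact: Gamma_unit_bij.
Qed.

Lemma killed_complete M : killed M -> complete I M.
Proof.
move=> M0; apply: isomorphic_sym.
by exists (Lambda_unit M); exact: Lambda_unit_bij.
Qed.

Lemma in_DP M : in_D I M <-> killed M.
Proof.
split=> [[torM redM]|M0]; last by split; [exact: killed_torsion|exact: killed_reduced].
exact: killed_isomorphic torM (reduced_Gamma_killed redM).
Qed.

Lemma in_EP M : in_E I M <-> killed M.
Proof.
split=> [[comM corM]|M0]; last by split; [exact: killed_complete|exact: killed_coreduced].
exact: killed_isomorphic comM (coreduced_Lambda_killed corM).
Qed.

Lemma torsionP M : ideal_exp I 2 =i I -> torsion I M <-> killed M.
Proof.
move=> I2; split=> [torM|]; last exact: killed_torsion.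
exact: killed_isomorphic torM (idempotent_Gamma_killed I2).
Qed.

Lemma completeP M : ideal_exp I 2 =i I -> complete I M <-> killed M.
Proof.
move=> I2; split=> [comM|]; last exact: killed_complete.
exact: killed_isomorphic comM (idempotent_Lambda_killed I2).
Qed.

End Killed.

Lemma full_subcat_eq_equivalent (C : category) (P Q : C -> Prop) :
  (forall x, P x <-> Q x) -> equivalent (full_subcat P) (full_subcat Q).
Proof.
move=> PQ; pose PQ1 x := proj1 (PQ x); pose QP1 x := proj2 (PQ x).
pose F := restrict (F := id_functor C) PQ1.
pose G := restrict (F := id_functor C) QP1.
exists F, G; split.
  apply: (@nat_iso_from_id _ (comp_functor G F) (fun x => idm x)).
    move=> x y f; exact: etrans (@comp_idl C _ _ f) (esym (@comp_idr C _ _ f)).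
  by move=> x; exists (idm x); exact: (@comp_idl C).
apply: (@nat_iso_from_id _ (comp_functor F G) (fun x => idm x)).
  move=> x y f; exact: etrans (@comp_idl C _ _ f) (esym (@comp_idr C _ _ f)).
by move=> x; exists (idm x); exact: (@comp_idl C).
Qed.

(** Bijective components suffice because the inverse of a bijective linear map
is linear. *)
Lemma Mod_nat_iso_from_id (R : comPzRingType) (P : Mod R -> Prop)
    (F : functor (full_subcat P) (full_subcat P))
    (eta : forall M : full_subcat P, {linear sval M -> sval (F M)}) :
    (forall (M N : full_subcat P) (f : {linear sval M -> sval N}) m,
       eta N (f m) =
       (fmap F (f : hom M N) : {linear sval (F M) -> sval (F N)}) (eta M m)) ->
    (forall M, bijective (eta M)) ->
  inhabited (nat_iso F (id_functor (full_subcat P))).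
Proof.
move=> etaN eta_bij; apply: (@nat_iso_from_id _ F eta) => [M N f|M].
  by apply: linear_ext => m; exact: etaN.
have [g etaK gK] := linear_inverse (eta_bij M).
by exists g; apply: linear_ext.
Qed.

Theorem theorem4p2 (R : comPzRingType) (I : submodClosed R^o) :
  [/\ forall M : lmodType R, reduced I M -> in_E I (Gamma I M),
      forall M : lmodType R, coreduced I M -> in_D I (Lambda I M),
      (forall M : lmodType R, reduced I M -> coreduced I (Gamma I M)) /\
      exists (GammaDE : forall M : Mod R, in_D I M -> in_E I (Gamma I M))
             (LambdaED : forall M : Mod R, in_E I M -> in_D I (Lambda I M)),
        quasi_inverse (restrict GammaDE) (restrict LambdaED)
    & ideal_exp I 2 =i I ->
      equivalent (full_subcat (C := Mod R) (complete I))
                 (full_subcat (C := Mod R) (torsion I))].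
Proof.
split.
- by move=> M redM; apply/in_EP/reduced_Gamma_killed.
- by move=> M corM; apply/in_DP/coreduced_Lambda_killed.
- split; first by move=> M redM; apply/killed_coreduced/reduced_Gamma_killed.
  have DE (M : Mod R) : in_D I M -> in_E I (Gamma I M).
    by case=> _ redM; apply/in_EP/reduced_Gamma_killed.
  have ED (M : Mod R) : in_E I M -> in_D I (Lambda I M).
    by case=> _ corM; apply/in_DP/coreduced_Lambda_killed.
  exists DE, ED; split.
    pose D0 (M : full_subcat (in_D I : Mod R -> Prop)) : killed I (sval M) :=
      proj1 (in_DP I (sval M)) (svalP M).
    apply: (@Mod_nat_iso_from_id _ _
      (comp_functor (restrict ED) (restrict DE))
      (fun M => Lambda_unit I (Gamma I (sval M)) \o Gamma_unit (D0 M))).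
      move=> M N f m.
      rewrite [LHS]/= (Gamma_unit_natural (D0 M)).
      exact: Lambda_unit_natural.
    move=> M; apply: bij_comp; last exact: Gamma_unit_bij.
    by apply: Lambda_unit_bij; apply/in_EP/DE/(svalP M).
  pose E0 (M : full_subcat (in_E I : Mod R -> Prop)) : killed I (sval M) :=
    proj1 (in_EP I (sval M)) (svalP M).
  pose L0 (M : full_subcat (in_E I : Mod R -> Prop)) :
      killed I (Lambda I (sval M)) := proj1 (in_DP I _) (ED _ (svalP M)).
  apply: (@Mod_nat_iso_from_id _ _
    (comp_functor (restrict DE) (restrict ED))
    (fun M => Gamma_unit (L0 M) \o Lambda_unit I (sval M))).
    move=> M N f m.
    rewrite [LHS]/= Lambda_unit_natural.
    exact: (Gamma_unit_natural (L0 M) (L0 N)).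
  move=> M; apply: bij_comp; first exact: Gamma_unit_bij.
  exact/Lambda_unit_bij/E0.
move=> I2; apply: full_subcat_eq_equivalent => M.
by rewrite torsionP // completeP.
Qed.
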